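(* Let $\mathcal{D}_A$ and $\mathcal{D}_B$ be any free quadrilaterals. Then there exists an invertible projective mapping $\mathcal{P}_W$ (with $W\in M_3(\mathbb{R})$) of $\mathcal{D}_A$ such that $\mathcal{P}_W(\mathcal{D}_A)=\mathcal{D}_B$.
   Context: $SM_n(\mathbb{R})^g$ is the set of $g$-tuples of real symmetric $n\times n$ matrices, $SM(\mathbb{R})^g=\bigcup_nSM_n(\mathbb{R})^g$. For $A\in SM_d(\mathbb{R})^g$, $L_A(X)=I_{dn}+\sum_{i=1}^gA_i\otimes X_i$ for $X\in SM_n(\mathbb{R})^g$, and the free spectrahedron is $\mathcal{D}_A=\{X\in SM(\mathbb{R})^g:L_A(X)\succeq0\}$, with $\mathcal{D}_A(n)=\mathcal{D}_A\cap SM_n(\mathbb{R})^g$. If $U^TAU=A^1\oplus A^2$ with $U$ orthogonal (coordinatewise), then $L_{A^1},L_{A^2}$ are subpencils of $L_A$; $A$ is a minimal defining tuple for $\mathcal{D}_A$ if no proper subpencil $L_{A^i}$ satisfies $\mathcal{D}_{A^i}=\mathcal{D}_A$. A free spectrahedron $K\subseteq SM(\mathbb{R})^2$ is a free quadrilateral if $K(1)\subset\mathbb{R}^2$ is a bounded quadrilateral in the classical sense and there is a pair $C=(C_1,C_2)$ of $4\times4$ real diagonal matrices with $K=\mathcal{D}_C$. For $(A_0,A)\in SM_d(\mathbb{R})^{g+1}$ the homogeneous free spectrahedron is $\mathcal{H}_{(A_0,A)}=\{(X_0,X)\in SM(\mathbb{R})^{g+1}:\sum_{i=0}^gA_i\otimes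 X_i\succeq0\}$. It is positive if $(1,0,\dots,0)\in\mathbb{R}^{g+1}$ is in the interior of its set of elements of size $1$. The homogenization of $\mathcal{D}_A$ is $\mathfrak{H}(\mathcal{D}_A)=\mathcal{H}_{(I,\check A)}$, where $\check A$ is any minimal defining tuple for $\mathcal{D}_A$ (independent of the choice). For a homogeneous free spectrahedron $\mathcal{H}$, $\mathfrak{H}^{-1}(\mathcal{H})=\{X\in SM(\mathbb{R})^g:(I,X)\in\mathcal{H}\}$. For $W\in M_{g+1}(\mathbb{R})$, $\mathcal{T}_W$ is the map on $(g+1)$-tuples $Z$ given by $\mathcal{T}_WZ=(\sum_jW_{1j}Z_j,\dots,\sum_jW_{(g+1)j}Z_j)$. $\mathcal{P}_W$ is a projective transformation (projective mapping) of $\mathcal{D}_A$ if $\mathcal{T}_W(\mathfrak{H}(\mathcal{D}_A))$ is a positive homogeneous free spectrahedron, in which case $\mathcal{P}_W(\mathcal{D}_A)=\mathfrak{H}^{-1}(\mathcal{T}_W(\mathfrak{H}(\mathcal{D}_A)))$; it is invertible if and only if $W$ is an invertible matrix. *)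

(* Defs.v *)
From HB Require Import structures.
From mathcomp Require Import all_boot all_order all_algebra.
From mathcomp Require Export mxtens.
From mathcomp Require Export all_classical all_reals all_analysis.

Set Implicit Arguments.
Unset Strict Implicit.
Unset Printing Implicit Defensive.

Import Order.TTheory GRing.Theory Num.Theory.
Import numFieldNormedType.Exports.

Local Open Scope classical_set_scope.
Local Open Scope ring_scope.

Section FreeSpectrahedra.
Variable R : realType.

(** A graded set of tuples of square matrices: the component at [n] is a set of
    [g]-tuples of [n x n] matrices.  The component at [n = 0] carries no
    information, since there is only one tuple of empty matrices. *)
Definition free_set (g : nat) : Type := forall n : nat, set ('I_g -> 'M[R]_n).

(** Membership in SM_n(R)^g. *)
Definition symmetric_tuple (g n : nat) (X : 'I_g -> 'M[R]_n) : Prop :=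
  forall i, (X i)^T = X i.

Definition psdmx (n : nat) (M : 'M[R]_n) : Prop :=
  M^T = M /\ forall v : 'cV[R]_n, 0 <= (v^T *m M *m v) 0 0.

(** [A *t B] is the Kronecker product. *)
Definition pencil (g d n : nat) (A : 'I_g -> 'M[R]_d) (X : 'I_g -> 'M[R]_n) :
    'M[R]_(d * n) :=
  1%:M + \sum_(i < g) A i *t X i.

Definition free_spectrahedron (g d : nat) (A : 'I_g -> 'M[R]_d) : free_set g :=
  fun n => [set X | symmetric_tuple X /\ psdmx (pencil A X)].

(** [U^T A U = A1 (+) A2] with [U] orthogonal.  The column index of [U] is
    ['I_(d1 + d2)], which avoids a cast along [d = d1 + d2]; this equality follows
    from the two orthogonality conditions. *)
Definition splits_as (g d d1 d2 : nat) (A : 'I_g -> 'M[R]_d)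
    (A1 : 'I_g -> 'M[R]_d1) (A2 : 'I_g -> 'M[R]_d2) : Prop :=
  exists U : 'M[R]_(d, d1 + d2),
    [/\ U^T *m U = 1%:M, U *m U^T = 1%:M &
        forall i, U^T *m A i *m U = block_mx (A1 i) 0 0 (A2 i)].

(** [A] is a minimal defining tuple for [K].  The blocks of a splitting are
    required to be nonempty, so that both subpencils are proper. *)
Definition minimal_defining_tuple (g d : nat) (K : free_set g)
    (A : 'I_g -> 'M[R]_d) : Prop :=
  [/\ (0 < d)%N, symmetric_tuple A, free_spectrahedron A = K &
      forall (d1 d2 : nat) (A1 : 'I_g -> 'M[R]_d1) (A2 : 'I_g -> 'M[R]_d2),
        (0 < d1)%N -> (0 < d2)%N -> splits_as A A1 A2 ->
        free_spectrahedron A1 <> K /\ free_spectrahedron A2 <> K].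

(** The tuple [(X0, X)]; index [0] is the homogenizing coordinate. *)
Definition cons_tuple (g n : nat) (X0 : 'M[R]_n) (X : 'I_g -> 'M[R]_n) :
    'I_g.+1 -> 'M[R]_n :=
  fun i => if unlift ord0 i is Some j then X j else X0.

Definition hom_free_spectrahedron (g d : nat) (A : 'I_g.+1 -> 'M[R]_d) :
    free_set g.+1 :=
  fun n => [set X | symmetric_tuple X /\ psdmx (\sum_(i < g.+1) A i *t X i)].

Definition is_hom_free_spectrahedron (g : nat) (H : free_set g.+1) : Prop :=
  exists (d : nat) (A : 'I_g.+1 -> 'M[R]_d),
    [/\ (0 < d)%N, symmetric_tuple A & H = hom_free_spectrahedron A].

(** The elements of size 1, as a subset of R^g. *)
Definition level1 (g : nat) (K : free_set g) : set 'rV[R]_g :=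
  [set x | K 1%N (fun i => (x 0 i)%:M)].

Definition positive (g : nat) (H : free_set g.+1) : Prop :=
  interior (level1 H) (delta_mx 0 0).

(** The set defined by [(I, A)] for a minimal defining tuple [A] of [K].  For a
    free spectrahedron [K] such an [A] exists and the set defined by [(I, A)] does
    not depend on it, so the union over all choices taken here is this set. *)
Definition homogenization (g : nat) (K : free_set g) : free_set g.+1 :=
  fun n => [set X | exists (d : nat) (A : 'I_g -> 'M[R]_d),
    minimal_defining_tuple K A /\
    hom_free_spectrahedron (cons_tuple 1%:M A) X].

Definition dehomogenization (g : nat) (H : free_set g.+1) : free_set g :=
  fun n => [set X | symmetric_tuple X /\ H n (cons_tuple 1%:M X)].

Definition lin_tuple (g n : nat) (W : 'M[R]_g) (Z : 'I_g -> 'M[R]_n) :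
    'I_g -> 'M[R]_n :=
  fun i => \sum_(j < g) W i j *: Z j.

Definition lin_image (g : nat) (W : 'M[R]_g) (K : free_set g) : free_set g :=
  fun n => lin_tuple W @` K n.

Definition projective_transformation (g : nat) (W : 'M[R]_g.+1)
    (K : free_set g) : Prop :=
  is_hom_free_spectrahedron (lin_image W (homogenization K)) /\
  positive (lin_image W (homogenization K)).

Definition projective_image (g : nat) (W : 'M[R]_g.+1) (K : free_set g) :
    free_set g :=
  dehomogenization (lin_image W (homogenization K)).

Definition convex_hull (g k : nat) (v : 'I_k -> 'rV[R]_g) : set 'rV[R]_g :=
  [set x | exists t : 'I_k -> R,
    [/\ forall i, 0 <= t i, \sum_(i < k) t i = 1 &
        x = \sum_(i < k) t i *: v i]].

(** A bounded (filled, convex) quadrilateral: the convex hull of four points none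
    of which lies in the convex hull of the other three. *)
Definition quadrilateral (S : set 'rV[R]_2) : Prop :=
  exists v : 'I_4 -> 'rV[R]_2,
    (forall i : 'I_4, ~ convex_hull (fun j : 'I_3 => v (lift i j)) (v i)) /\
    S = convex_hull v.

Definition free_quadrilateral (K : free_set 2) : Prop :=
  quadrilateral (level1 K) /\
  exists C : 'I_2 -> 'M[R]_4,
    (forall i, is_diag_mx (C i)) /\ K = free_spectrahedron C.

End FreeSpectrahedra.

(* Main.v *)
(** All defining tuples of K (minimal or not) have the same homogenization when
    K(1) is bounded.  Boundedness forces X0 >= 0 on H_(I,A), by compressing
    (X0, X) to a vector v; after X0 is replaced by X0 + eps, a congruence
    normalizes it to the identity, so that membership is membership in K; then
    eps tends to 0.  Hence the homogenization of a free quadrilateral D_C, with C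
    diagonal, is given by four linear inequalities on (X0, X1, X2).

    Lift the vertices of K(1) to R^3.  Their only linear relation has two positive
    and two negative coefficients, so the lifts, in cyclic order, can be scaled to
    p, q, r, s with p + r = q + s, and p, q, r is a basis.  The midpoint of each
    edge lies on the boundary of the cone, so one of the four functionals vanishes
    on that edge; this identifies the functionals up to positive factors.  In the
    basis p, q, r the homogenization becomes the fixed model
    {Z : Z0, Z2, Z0 + Z1, Z1 + Z2 >= 0}, at every matrix size.  Two free
    quadrilaterals are both linear images of this model, and W is the composite
    of one linear map with the inverse of the other. *)
Require Import Defs.
From mathcomp Require Import all_boot all_order all_algebra.
From mathcomp Require Import all_classical all_reals all_analysis.
From mathcomp Require Import ring lra.

Set Implicit Arguments.
Unset Strict Implicit.
Unset Printing Implicit Defensive.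

Import Order.TTheory GRing.Theory Num.Theory.
Import numFieldNormedType.Exports.
(* The libraries above shadow [cons_tuple] of [Defs]. *)
Import Defs.

Local Open Scope classical_set_scope.
Local Open Scope ring_scope.

(** * Positive semidefinite and positive definite matrices, and congruence *)

Section PositiveMatrices.
Variable R : realType.

Lemma trmx_congr m n (M : 'M[R]_m) (P : 'M[R]_(m, n)) :
  M^T = M -> (P^T *m M *m P)^T = P^T *m M *m P.
Proof. by move=> sM; rewrite !trmx_mul trmxK sM mulmxA. Qed.

Lemma psdmx_congr m n (M : 'M[R]_m) (P : 'M[R]_(m, n)) :
  psdmx M -> psdmx (P^T *m M *m P).
Proof.
move=> [sM pM]; split=> [|v]; first exact: trmx_congr.
by have := pM (P *m v); rewrite trmx_mul !mulmxA.
Qed.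

Lemma psdmxD n (M N : 'M[R]_n) : psdmx M -> psdmx N -> psdmx (M + N).
Proof.
move=> [sM pM] [sN pN]; split=> [|v]; first by rewrite linearD /= sM sN.
by rewrite mulmxDr mulmxDl mxE addr_ge0.
Qed.

Lemma psdmxZ n (a : R) (M : 'M[R]_n) : 0 <= a -> psdmx M -> psdmx (a *: M).
Proof.
move=> a0 [sM pM]; split=> [|v]; first by rewrite linearZ /= sM.
by rewrite -scalemxAr -scalemxAl mxE mulr_ge0.
Qed.

Lemma dotmx_ge0 n (v : 'cV[R]_n) : 0 <= (v^T *m v) 0 0.
Proof. by rewrite mxE sumr_ge0 // => i _; rewrite mxE -expr2 sqr_ge0. Qed.

Lemma dotmx_eq0 n (v : 'cV[R]_n) : (v^T *m v) 0 0 = 0 -> v = 0.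
Proof.
rewrite mxE => /eqP; rewrite psumr_eq0 => [/allP v0|i _]; last first.
  by rewrite mxE -expr2 sqr_ge0.
apply/colP=> i; have := v0 i; rewrite mem_index_enum => /(_ isT).
by rewrite !mxE mulf_eq0 orbb => /eqP.
Qed.

Lemma psdmx1 n : psdmx (1%:M : 'M[R]_n).
Proof. by split=> [|v]; rewrite ?trmx1 // mulmx1 dotmx_ge0. Qed.

Lemma psdmx_scalar n (a : R) : 0 <= a -> psdmx (a%:M : 'M[R]_n).
Proof. by move=> a0; rewrite -scalemx1; apply: psdmxZ => //; exact: psdmx1. Qed.

Lemma quad_shift n (M : 'M[R]_n) (a : R) (v : 'cV[R]_n) :
  (v^T *m (M + a%:M) *m v) 0 0 = (v^T *m M *m v) 0 0 + a * (v^T *m v) 0 0.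
Proof. by rewrite mulmxDr mulmxDl mul_mx_scalar -scalemxAl [LHS]mxE [X in _ + X]mxE. Qed.

Lemma psdmx_closed n (M : 'M[R]_n) :
  (forall eps, 0 < eps -> psdmx (M + eps%:M)) -> psdmx M.
Proof.
move=> Meps; split=> [|v].
  have [+ _] := Meps 1 ltr01.
  by rewrite linearD /= tr_scalar_mx => /addIr.
set s := (v^T *m v) 0 0; have s0 : 0 <= s := dotmx_ge0 v.
rewrite leNgt; apply/negP; set q := (X in X < 0) => q0.
have s1 : 0 < s + 1 by lra.
(* For this shift the form at [v] becomes [q / (s + 1)], which is still negative. *)
have e0 : 0 < - q / (s + 1) by rewrite divr_gt0 // oppr_gt0.
have [_ /(_ v)] := Meps _ e0.
rewrite quad_shift -/q -/s; apply/negP; rewrite -ltNge.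
have -> : q + - q / (s + 1) * s = q / (s + 1) by field; lra.
by rewrite pmulr_llt0 // invr_gt0.
Qed.

Definition posdefmx n (M : 'M[R]_n) : Prop :=
  M^T = M /\ forall v : 'cV[R]_n, v != 0 -> 0 < (v^T *m M *m v) 0 0.

Lemma posdefmx_congr n (M P : 'M[R]_n) :
  P \in unitmx -> posdefmx M -> posdefmx (P^T *m M *m P).
Proof.
move=> uP [sM pM]; split=> [|v v0]; first exact: trmx_congr.
have := pM (P *m v); rewrite trmx_mul !mulmxA; apply.
by apply: contraNneq v0 => Pv0; rewrite -(mulKmx uP v) Pv0 mulmx0.
Qed.

Lemma psdmx_posdefmx n (M : 'M[R]_n) (eps : R) :
  0 < eps -> psdmx M -> posdefmx (M + eps%:M).
Proof.
move=> e0 [sM pM]; split=> [|v v0]; first by rewrite linearD /= tr_scalar_mx sM.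
rewrite quad_shift ltr_wpDl // mulr_gt0 // lt_def dotmx_ge0 andbT.
by apply: contraNneq v0 => /dotmx_eq0 ->.
Qed.

Lemma posdefmx_block m n (M : 'M[R]_m) (N : 'M[R]_n) :
  posdefmx (block_mx M 0 0 N) -> posdefmx M /\ posdefmx N.
Proof.
move=> [sMN pMN].
have := sMN; rewrite tr_block_mx !trmx0 => /eq_block_mx [sM _ _ sN].
split; split=> // v v0.
- have := pMN (col_mx v 0); rewrite tr_col_mx trmx0 mul_row_block mul_row_col.
  rewrite !mulmx0 !addr0; apply.
  by rewrite -col_mx0; apply: contraNneq v0 => /eq_col_mx[-> _].
- have := pMN (col_mx 0 v); rewrite tr_col_mx trmx0 mul_row_block mul_row_col.
  rewrite !mulmx0 !add0r; apply.
  by rewrite -col_mx0; apply: contraNneq v0 => /eq_col_mx[_ ->].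
Qed.

Lemma unitmx_block_diag m n (M : 'M[R]_m) (N : 'M[R]_n) :
  M \in unitmx -> N \in unitmx -> block_mx M 0 0 N \in unitmx.
Proof. by move=> uM uN; rewrite unitmxE det_ublock unitrM -!unitmxE uM. Qed.

(** Symmetric Gaussian elimination by induction on the size. The congruence [P1] clears the first
    row and column against the pivot [a], the Schur complement stays positive definite and is
    normalized by induction, and [P2] rescales the pivot by the inverse of its square root. *)
Lemma posdefmx_congr1 n (M : 'M[R]_n) :
  posdefmx M -> exists2 P : 'M[R]_n, P \in unitmx & P^T *m M *m P = 1%:M.
Proof.
elim: n M => [|n IHn] M pM.
  by exists 1%:M; rewrite ?unitmx1 //; apply/matrixP => -[].
rewrite -[n.+1]/(1 + n)%N in M pM *.
have [sM qM] := pM.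
pose a := ulsubmx M 0 0; pose b := dlsubmx M; pose D := drsubmx M.
have defM : M = block_mx a%:M b^T b D.
  rewrite -[LHS]submxK -mx11_scalar trmx_dlsub sM //.
(* The pivot is the value of the form at the first basis vector. *)
have a0 : 0 < a.
  have := qM (col_mx 1 0); rewrite defM tr_col_mx mul_row_block mul_row_col.
  rewrite !trmx1 !trmx0 !mulmx0 !mul1mx !mul0mx !addr0 mulmx1 mxE; apply.
  by rewrite -col_mx0; apply/negP=> /eqP/eq_col_mx[/eqP]; rewrite oner_eq0.
pose P1 : 'M[R]_(1 + n) := block_mx 1 (- a^-1 *: b^T) 0 1%:M.
have uP1 : P1 \in unitmx by rewrite unitmxE det_ublock !det1 mulr1 unitr1.
have trbE : (- a^-1 *: b^T)^T = - a^-1 *: b by rewrite linearZ /= trmxK.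
have P1M : P1^T *m M *m P1 = block_mx a%:M 0 0 (D - a^-1 *: (b *m b^T)).
  rewrite defM tr_block_mx !mulmx_block !trmx1 !trmx0 !mul0mx !mulmx0 !mul1mx.
  rewrite !addr0 !mulmx1 trbE; congr block_mx.
  - by rewrite mul_scalar_mx scalerA mulrN divff ?gt_eqF // scaleN1r addNr.
  - by rewrite mul_mx_scalar scalerA mulrN divff ?gt_eqF // scaleN1r addNr.
  - rewrite mul_mx_scalar scalerA mulrN divff ?gt_eqF // scaleN1r addNr mul0mx.
    by rewrite add0r -scalemxAl addrC scaleNr.
have [_ /IHn [Q uQ QE]] : posdefmx (a%:M : 'M[R]_1) /\ posdefmx (D - a^-1 *: (b *m b^T)).
  by apply: posdefmx_block; rewrite -P1M; exact: posdefmx_congr.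
pose P2 : 'M[R]_(1 + n) := block_mx ((Num.sqrt a)^-1)%:M 0 0 Q.
have s0 : 0 < Num.sqrt a by rewrite sqrtr_gt0.
exists (P1 *m P2).
  rewrite unitmx_mul uP1 unitmx_block_diag //.
  by rewrite unitmxE det_scalar1 unitfE invr_eq0 gt_eqF.
have -> : (P1 *m P2)^T *m M *m (P1 *m P2) = P2^T *m (P1^T *m M *m P1) *m P2.
  by rewrite trmx_mul !mulmxA.
rewrite P1M tr_block_mx !mulmx_block !trmx0 !mul0mx !mulmx0 !addr0 !add0r QE.
rewrite tr_scalar_mx -!scalar_mxM.
have -> : (Num.sqrt a)^-1 * a * (Num.sqrt a)^-1 = 1.
  by rewrite -{2}(sqr_sqrtr (ltW a0)); field; rewrite gt_eqF.
by rewrite !mul0mx -scalar_mx_block.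
Qed.

End PositiveMatrices.

(** * Homogeneous pencils, compression and the effect of boundedness *)

Section Pencils.
Variable R : realType.

Lemma tensmxDr m n p q (A : 'M[R]_(m, n)) (M N : 'M[R]_(p, q)) :
  A *t (M + N) = A *t M + A *t N.
Proof. by apply/matrixP=> i j; rewrite !mxE mulrDr. Qed.

Lemma tensmxZr m n p q (a : R) (A : 'M[R]_(m, n)) (M : 'M[R]_(p, q)) :
  A *t (a *: M) = a *: (A *t M).
Proof. by apply/matrixP=> i j; rewrite !mxE mulrCA. Qed.

Lemma tensmx11 m n : (1%:M : 'M[R]_m) *t (1%:M : 'M[R]_n) = 1%:M.
Proof.
apply/matrixP=> i j; case: (mxtens_indexP i) => i1 i2.
case: (mxtens_indexP j) => j1 j2; rewrite tensmxE !mxE -natrM mulnb.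
by rewrite (can_eq (@mxtens_indexK _ _)) xpair_eqE.
Qed.

Lemma tens1_scalar m n (a : R) : (1%:M : 'M[R]_m) *t (a%:M : 'M[R]_n) = a%:M.
Proof. by rewrite -[a%:M in LHS]scalemx1 tensmxZr tensmx11 scalemx1. Qed.

Definition hpencil g d n (A : 'I_g -> 'M[R]_d) (X : 'I_g -> 'M[R]_n) :
  'M[R]_(d * n) := \sum_(i < g) A i *t X i.

Lemma hpencil_congr g d m n (A : 'I_g -> 'M[R]_d) (X : 'I_g -> 'M[R]_m)
    (P : 'M[R]_(m, n)) :
  hpencil A (fun i => P^T *m X i *m P) =
  (1%:M *t P)^T *m hpencil A X *m (1%:M *t P).
Proof.
rewrite /hpencil mulmx_sumr mulmx_suml; apply: eq_bigr => i _.
by rewrite trmx_tens trmx1 !tensmx_mul mul1mx mulmx1.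
Qed.

Lemma pencilE g d n (A : 'I_g -> 'M[R]_d) (X : 'I_g -> 'M[R]_n) :
  pencil A X = hpencil (cons_tuple 1%:M A) (cons_tuple 1%:M X).
Proof.
rewrite /hpencil big_ord_recl /cons_tuple unlift_none tensmx11.
by congr (_ + _); apply: eq_bigr => i _; rewrite liftK.
Qed.

(** The head coefficient is the identity, so a scalar shift of [X ord0] shifts the whole pencil by
    the same scalar. This lets the perturbation by eps act on the head alone. *)
Lemma hpencil_shift g d n (A : 'I_g -> 'M[R]_d) (X : 'I_g.+1 -> 'M[R]_n) (a : R) :
  hpencil (cons_tuple 1%:M A)
    (cons_tuple (X ord0 + a%:M) (fun i => X (lift ord0 i))) =
  hpencil (cons_tuple 1%:M A) X + a%:M.
Proof.
rewrite /hpencil !big_ord_recl /cons_tuple unlift_none tensmxDr.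
rewrite tens1_scalar addrAC; congr (_ + _ + _).
by apply: eq_bigr => i _; rewrite !liftK.
Qed.

Lemma symmetric_cons_tuple g n (X0 : 'M[R]_n) (X : 'I_g -> 'M[R]_n) :
  X0^T = X0 -> symmetric_tuple X -> symmetric_tuple (cons_tuple X0 X).
Proof. by move=> s0 sX i; rewrite /cons_tuple; case: unliftP => [j|] _. Qed.

Lemma free_spectrahedronE g d n (A : 'I_g -> 'M[R]_d) (X : 'I_g -> 'M[R]_n) :
  free_spectrahedron A X <->
  hom_free_spectrahedron (cons_tuple 1%:M A) (cons_tuple 1%:M X).
Proof.
rewrite /free_spectrahedron /hom_free_spectrahedron /= pencilE.
split=> -[sX pX]; split=> //; first by apply: symmetric_cons_tuple; rewrite ?trmx1.
by move=> i; have := sX (lift ord0 i); rewrite /cons_tuple liftK.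
Qed.

Lemma hom_free_spectrahedron_congr g d m n (A : 'I_g.+1 -> 'M[R]_d)
    (X : 'I_g.+1 -> 'M[R]_m) (P : 'M[R]_(m, n)) :
  hom_free_spectrahedron A X ->
  hom_free_spectrahedron A (fun i => P^T *m X i *m P).
Proof.
move=> [sX pX]; split; first by move=> i; exact: trmx_congr.
by have := psdmx_congr (1%:M *t P) pX; rewrite -hpencil_congr.
Qed.

Definition bounded_level1 g (K : free_set R g) : Prop :=
  exists M : R, forall x, level1 K x -> forall i, `|x 0 i| <= M.

Lemma bounded_level1_ray g (K : free_set R g) (x : 'rV[R]_g) :
  bounded_level1 K -> (forall t, 0 <= t -> level1 K (t *: x)) -> x = 0.
Proof.
move=> [M KM] Kx; apply/rowP=> i; rewrite mxE; apply/eqP.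
apply: contraT; rewrite -normr_gt0 => xi0.
have M0 : 0 <= M.
  by have /KM/(_ i) := Kx 0 (lexx _); rewrite mxE mul0r normr0.
have t0 : 0 <= (M + 1) / `|x 0 i| by rewrite divr_ge0 ?ltW //; lra.
have /KM/(_ i) := Kx _ t0; rewrite mxE normrM (ger0_norm t0).
by rewrite divfK ?gt_eqF //; lra.
Qed.

Lemma psdmx_diag_ge0 n (M : 'M[R]_n) i : psdmx M -> 0 <= M i i.
Proof.
by case=> _ /(_ (delta_mx i 0)); rewrite trmx_delta -rowE -colE !mxE.
Qed.

(** Suppose the head takes a value [q < 0] at [v]. Compression to [v] gives a point [x] with
    [S + q%:M] positive semidefinite, and then the whole ray through [x] lies in the bounded level
    1. Hence [x = 0] and [S = 0], which leaves [q%:M] positive semidefinite, a contradiction. *)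
Lemma hom_free_spectrahedron_head g d n (A : 'I_g -> 'M[R]_d)
    (X : 'I_g.+1 -> 'M[R]_n) :
  (0 < d)%N -> bounded_level1 (free_spectrahedron A) ->
  hom_free_spectrahedron (cons_tuple 1%:M A) X -> psdmx (X ord0).
Proof.
move=> d0 bA HX; split=> [|v]; first by have [] := HX.
rewrite leNgt; apply/negP; set q := (X in X < 0) => q0.
have [_] := hom_free_spectrahedron_congr v HX.
pose x := \row_i (v^T *m X (lift ord0 i) *m v) 0 0.
pose S := \sum_i A i *t ((x 0 i)%:M : 'M[R]_1).
have -> : \sum_i cons_tuple 1%:M A i *t (v^T *m X i *m v) = S + q%:M.
  rewrite big_ord_recl /cons_tuple unlift_none [v^T *m _ *m v]mx11_scalar -/q.
  rewrite tens1_scalar addrC; congr (_ + _).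
  by apply: eq_bigr => i _; rewrite liftK mxE -mx11_scalar.
move=> pS.
have x0 : x = 0.
  apply: (bounded_level1_ray bA) => t t0; split=> [i|]; first exact: tr_scalar_mx.
  (* A sum of three positive semidefinite terms; the last one is so because [q] is negative. *)
  have -> : pencil A (fun i => ((t *: x) 0 i)%:M) =
            1%:M + t *: (S + q%:M) + (- t * q)%:M.
    rewrite /pencil -addrA; congr (_ + _).
    rewrite scalerDr scale_scalar_mx -addrA -raddfD /= mulNr subrr raddf0 addr0.
    rewrite scaler_sumr; apply: eq_bigr => i _.
    by rewrite mxE -scale_scalar_mx tensmxZr.
  apply: psdmxD; first by apply: psdmxD; [exact: psdmx1 | exact: psdmxZ].
  by apply: psdmx_scalar; rewrite mulNr -mulrN mulr_ge0 // oppr_ge0 ltW.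
have S0 : S = 0.
  by rewrite /S big1 // => i _; rewrite x0 mxE raddf0 tensmx0.
(* Since [d] is positive, [q%:M] has a diagonal entry, and it equals [q]. *)
have /(psdmx_diag_ge0 (mxtens_index (Ordinal d0, 0))) := pS.
by rewrite S0 add0r mxE eqxx mulr1n leNgt q0.
Qed.

(** One inclusion between the homogenizations of two defining tuples; [homogenizationE] uses it both
    from a minimal tuple and towards one. *)
Lemma hom_free_spectrahedron_sub g d e n (A : 'I_g -> 'M[R]_d)
    (B : 'I_g -> 'M[R]_e) (X : 'I_g.+1 -> 'M[R]_n) :
  (0 < d)%N -> bounded_level1 (free_spectrahedron A) ->
  free_spectrahedron A = free_spectrahedron B ->
  hom_free_spectrahedron (cons_tuple 1%:M A) X ->
  hom_free_spectrahedron (cons_tuple 1%:M B) X.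
Proof.
move=> d0 bA AB HX; have [sX pX] := HX; split=> //.
apply: psdmx_closed => eps eps0.
have pX0 := hom_free_spectrahedron_head d0 bA HX.
have [P uP PE] := posdefmx_congr1 (psdmx_posdefmx eps0 pX0).
pose X' := cons_tuple (X ord0 + eps%:M) (fun i => X (lift ord0 i)).
have HX' : hom_free_spectrahedron (cons_tuple 1%:M A) X'.
  split.
    by apply: symmetric_cons_tuple => [|i]; rewrite ?linearD /= ?tr_scalar_mx sX.
  rewrite -/(hpencil _ _) hpencil_shift.
  by apply: psdmxD => //; apply: psdmx_scalar; exact: ltW.
pose Y i := P^T *m X' (lift ord0 i) *m P.
have YE : (fun i => P^T *m X' i *m P) = cons_tuple 1%:M Y.
  apply/funext => i; rewrite /cons_tuple; case: unliftP => [j|] -> //.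
  by rewrite /X' /cons_tuple unlift_none.
(* After congruence by [P] the head is the identity, so [A] can be exchanged for [B] inside the free
   spectrahedron; congruence by [invmx P] then returns to [X']. *)
have := hom_free_spectrahedron_congr P HX'.
rewrite YE => /free_spectrahedronE; rewrite AB => /free_spectrahedronE.
rewrite -YE => /(hom_free_spectrahedron_congr (invmx P)) [_].
rewrite -/(hpencil _ _).
have -> : (fun i => (invmx P)^T *m (P^T *m X' i *m P) *m invmx P) = X'.
  apply/funext => i; rewrite -!mulmxA mulmxV // mulmx1 mulmxA -trmx_mul.
  by rewrite mulmxV // trmx1 mul1mx.
by rewrite /X' hpencil_shift.
Qed.

End Pencils.

(** * Minimal defining tuples and the homogenization of a bounded free spectrahedron *)

Section Homogenization.
Variable R : realType.

Lemma splits_as_dim g d d1 d2 (A : 'I_g -> 'M[R]_d)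
    (A1 : 'I_g -> 'M[R]_d1) (A2 : 'I_g -> 'M[R]_d2) :
  splits_as A A1 A2 -> d = (d1 + d2)%N.
Proof.
move=> [U [UTU UUT _]]; apply/eqP; by rewrite eqn_leq (mulmx1_min UUT) (mulmx1_min UTU).
Qed.

Lemma splits_as_symmetric g d d1 d2 (A : 'I_g -> 'M[R]_d)
    (A1 : 'I_g -> 'M[R]_d1) (A2 : 'I_g -> 'M[R]_d2) :
  symmetric_tuple A -> splits_as A A1 A2 ->
  symmetric_tuple A1 /\ symmetric_tuple A2.
Proof.
move=> sA [U [_ _ UA]]; split=> i; have := trmx_congr U (sA i);
  by rewrite UA tr_block_mx => /eq_block_mx[].
Qed.

(** Strong induction on the size: a tuple that is not minimal splits off a subpencil defining the
    same set, and this is smaller because the other block is nonempty. *)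
Lemma minimal_defining_tuple_exists g d (K : free_set R g) (A : 'I_g -> 'M[R]_d) :
  (0 < d)%N -> symmetric_tuple A -> free_spectrahedron A = K ->
  exists e (B : 'I_g -> 'M[R]_e), minimal_defining_tuple K B.
Proof.
elim/ltn_ind: d A => d IHd A d0 sA AK.
have [minA|notminA] := pselect (minimal_defining_tuple K A); first by exists d, A.
apply: contrapT => nex; apply: notminA; split=> // d1 d2 A1 A2 d10 d20 sp.
have dE := splits_as_dim sp; have [sA1 sA2] := splits_as_symmetric sA sp.
have lt1 : (d1 < d)%N by rewrite dE -addn1 leq_add2l.
have lt2 : (d2 < d)%N by rewrite dE -add1n leq_add2r.
by split=> AiK; apply: nex; [exact: (IHd d1 lt1 A1) | exact: (IHd d2 lt2 A2)].
Qed.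

Lemma homogenizationE g d (A : 'I_g -> 'M[R]_d) :
  (0 < d)%N -> symmetric_tuple A -> bounded_level1 (free_spectrahedron A) ->
  homogenization (free_spectrahedron A) = hom_free_spectrahedron (cons_tuple 1%:M A).
Proof.
move=> d0 sA bA; apply/functional_extensionality_dep => n; apply/seteqP; split=> X /=.
  move=> [e [B [[e0 sB BA _] HX]]].
  by apply: (hom_free_spectrahedron_sub e0 _ BA) HX; rewrite BA.
move=> HX; have [e [B minB]] := minimal_defining_tuple_exists d0 sA erefl.
exists e, B; split=> //; have [e0 sB BA _] := minB.
exact: (hom_free_spectrahedron_sub d0 _ (esym BA)) HX.
Qed.

(** * Pencils with diagonal coefficients *)

Lemma quadE n (M : 'M[R]_n) (v : 'cV[R]_n) :
  (v^T *m M *m v) 0 0 = \sum_i \sum_j v i 0 * M i j * v j 0.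
Proof.
rewrite mxE exchange_big; apply: eq_bigr => j _; rewrite mxE mulr_suml.
by apply: eq_bigr => i _; rewrite mxE.
Qed.

Lemma sum_mxtens_index d n (F : 'I_(d * n) -> R) :
  \sum_k F k = \sum_j \sum_a F (mxtens_index (j, a)).
Proof.
rewrite (reindex (@mxtens_index d n)) /=; last first.
  by apply: onW_bij; exists (@mxtens_unindex d n);
    [exact: mxtens_indexK | exact: mxtens_unindexK].
by rewrite pair_bigA; apply: eq_bigr => -[j a].
Qed.

(** With diagonal coefficients the pencil is block diagonal. The vector [v] is cut into [d] pieces
    of length [n], and piece [j] meets only the block built from the [j]-th diagonal entries. *)
Lemma quad_hpencil_diag g d n (C : 'I_g -> 'M[R]_d) (X : 'I_g -> 'M[R]_n)
    (v : 'cV[R]_(d * n)) :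
  (forall i, is_diag_mx (C i)) ->
  (v^T *m hpencil C X *m v) 0 0 =
  \sum_j ((\col_a v (mxtens_index (j, a)) 0)^T *m (\sum_i C i j j *: X i) *m
            (\col_a v (mxtens_index (j, a)) 0)) 0 0.
Proof.
move=> dC; rewrite quadE.
rewrite sum_mxtens_index; apply: eq_bigr => j _; rewrite quadE.
apply: eq_bigr => a _; rewrite sum_mxtens_index.
rewrite (bigD1 j) //= [X in _ + X]big1 ?addr0 => [|k kj].
  apply: eq_bigr => b _; rewrite !mxE; congr (_ * _ * _).
  rewrite !summxE; apply: eq_bigr => i _.
  by rewrite tensmxE mxE.
rewrite big1 // => b _; rewrite summxE big1 ?mulr0 ?mul0r // => i _.
by rewrite tensmxE (is_diag_mxP (dC i)) ?mul0r // eq_sym.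
Qed.

Lemma psdmx_hpencil_diag g d n (C : 'I_g -> 'M[R]_d) (X : 'I_g -> 'M[R]_n) :
  (forall i, is_diag_mx (C i)) -> symmetric_tuple X ->
  psdmx (hpencil C X) <-> forall j, psdmx (\sum_i C i j j *: X i).
Proof.
move=> dC sX; split=> [[_ pCX] j|pCX].
  split=> [|w].
    by rewrite linear_sum; apply: eq_bigr => i _; rewrite linearZ /= sX.
  (* The vector [w] placed in block [j], with zeros elsewhere, isolates that block. *)
  pose v : 'cV[R]_(d * n) :=
    \col_k (if (mxtens_unindex k).1 == j then w (mxtens_unindex k).2 0 else 0).
  have := pCX v; rewrite quad_hpencil_diag // (bigD1 j) //= [X in _ + X]big1 ?addr0.
    have -> // : \col_a v (mxtens_index (j, a)) 0 = w.
    by apply/colP=> a; rewrite !mxE mxtens_indexK /= eqxx.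
  move=> k kj; have -> : \col_a v (mxtens_index (k, a)) 0 = 0.
    by apply/colP=> a; rewrite !mxE mxtens_indexK /= (negPf kj).
  by rewrite mulmx0 mxE.
split=> [|v]; last first.
  by rewrite quad_hpencil_diag // sumr_ge0 // => j _; have [_] := pCX j; apply.
rewrite /hpencil linear_sum; apply: eq_bigr => i _.
rewrite /= trmx_tens sX; congr (_ *t _); apply/matrixP=> a b; rewrite mxE.
case: (eqVneq a b) => [-> //|ab].
by rewrite !(is_diag_mxP (dC i)) // eq_sym.
Qed.

(** * Linear changes of variables and dehomogenization *)

Lemma lin_tupleM g n (W V : 'M[R]_g) (Z : 'I_g -> 'M[R]_n) :
  lin_tuple (W *m V) Z = lin_tuple W (lin_tuple V Z).
Proof.
apply/funext=> i; rewrite /lin_tuple.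
under [RHS]eq_bigr do rewrite scaler_sumr.
rewrite exchange_big; apply: eq_bigr => k _; rewrite mxE scaler_suml.
by apply: eq_bigr => j _; rewrite scalerA.
Qed.

Lemma lin_tuple1 g n (Z : 'I_g -> 'M[R]_n) : lin_tuple 1%:M Z = Z.
Proof.
apply/funext=> i; rewrite /lin_tuple (bigD1 i) //= mxE eqxx scale1r big1 ?addr0 //.
by move=> j ij; rewrite mxE eq_sym (negPf ij) scale0r.
Qed.

Lemma lin_imageM g (W V : 'M[R]_g) (K : free_set R g) :
  lin_image (W *m V) K = lin_image W (lin_image V K).
Proof.
apply/functional_extensionality_dep=> n; apply/seteqP; split=> X /=.
  by move=> [Z KZ <-]; exists (lin_tuple V Z); [exists Z | rewrite -lin_tupleM].
by move=> [_ [Z KZ <-] <-]; exists Z => //; rewrite lin_tupleM.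
Qed.

Lemma dehomogenization_free g d (A : 'I_g -> 'M[R]_d) :
  dehomogenization (hom_free_spectrahedron (cons_tuple 1%:M A)) =
  free_spectrahedron A.
Proof.
apply/functional_extensionality_dep=> n; apply/seteqP; split=> X.
  by move=> [_ HX]; exact/free_spectrahedronE.
by move=> AX; split; [have [] := AX | exact/free_spectrahedronE].
Qed.

(** * Linear inequalities at size one and positivity *)

Lemma is_diag_cons g d (C : 'I_g -> 'M[R]_d) :
  (forall i, is_diag_mx (C i)) -> forall i, is_diag_mx (cons_tuple 1%:M C i).
Proof.
by move=> dC i; rewrite /cons_tuple; case: unliftP => [j|] _ //; exact: scalar_mx_is_diag.
Qed.

Lemma is_diag_symmetric g d (C : 'I_g -> 'M[R]_d) :
  (forall i, is_diag_mx (C i)) -> symmetric_tuple C.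
Proof.
move=> dC i; apply/matrixP=> a b; rewrite mxE.
by case: (eqVneq a b) => [-> //|ab]; rewrite !(is_diag_mxP (dC i)) // eq_sym.
Qed.

Lemma psdmx_scalar1 (a : R) : psdmx (a%:M : 'M[R]_1) <-> 0 <= a.
Proof.
split=> [|a0]; last exact: psdmx_scalar.
by move=> /(psdmx_diag_ge0 0); rewrite mxE eqxx.
Qed.

Lemma level1_hom_diag g d (C : 'I_g -> 'M[R]_d) (x : 'rV[R]_g.+1) :
  (forall i, is_diag_mx (C i)) ->
  level1 (hom_free_spectrahedron (cons_tuple 1%:M C)) x <->
  forall j, 0 <= x 0 0 + \sum_(i < g) C i j j * x 0 (lift ord0 i).
Proof.
move=> dC; rewrite /level1 /hom_free_spectrahedron /=.
have sx : symmetric_tuple (fun i => ((x 0 i)%:M : 'M[R]_1)).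
  by move=> i; exact: tr_scalar_mx.
have E j : \sum_i cons_tuple 1%:M C i j j *: ((x 0 i)%:M : 'M[R]_1) =
    (x 0 0 + \sum_(i < g) C i j j * x 0 (lift ord0 i))%:M.
  rewrite big_ord_recl raddfD /= raddf_sum /=.
  rewrite /cons_tuple unlift_none mxE eqxx scale1r; congr (_ + _).
  by apply: eq_bigr => i _; rewrite liftK scale_scalar_mx.
split=> [[_ /(psdmx_hpencil_diag (is_diag_cons dC) sx) p] j|p].
  by have := p j; rewrite E => /psdmx_scalar1.
by split=> //; apply/(psdmx_hpencil_diag (is_diag_cons dC) sx) => j; rewrite E; exact/psdmx_scalar1.
Qed.

(** Each of the finitely many functionals equals 1 at the point (1, 0, ..., 0), so by continuity all
    of them stay positive on a neighbourhood. *)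
Lemma positive_hom_diag g d (C : 'I_g -> 'M[R]_d) :
  (forall i, is_diag_mx (C i)) ->
  positive (hom_free_spectrahedron (cons_tuple 1%:M C)).
Proof.
move=> dC; rewrite /positive /interior.
suff : nbhs (delta_mx 0 0 : 'rV[R]_g.+1) (fun x : 'rV[R]_g.+1 => forall j : 'I_d,
    0 < x 0 0 + \sum_(i < g) C i j j * x 0 (lift ord0 i)).
  by apply: filterS => x px; apply/(level1_hom_diag _ dC) => j; exact: ltW.
pose f j (x : 'rV[R]_g.+1) : R := x 0 0 + \sum_(i < g) C i j j * x 0 (lift ord0 i).
apply: (@filter_forall _ _ (fun j x => 0 < f j x) _ (nbhs_filter _)) => j.
have cf : continuous (f j).
  move=> x; apply: (@cvgD _ _ _ (nbhs x) (nbhs_filter x)).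
    exact: coord_continuous.
  apply: cvg_big; [exact: add_continuous | move=> i _].
  by apply: cvgM; [exact: cvg_cst | exact: coord_continuous].
have f0 : 0 < f j (delta_mx 0 0).
  by rewrite /f mxE eqxx big1 ?addr0 // => i _; rewrite mxE mulr0.
exact: (cvgr_gt _ (cf _) _ f0).
Qed.

End Homogenization.

(** * Lifting points to height one, facet functionals and affine relations *)

Section Cones.
Variable R : realType.

Definition homogenize g (x : 'rV[R]_g) : 'rV[R]_g.+1 :=
  \row_i (if unlift ord0 i is Some j then x 0 j else 1).

(** Column [j] holds the coefficients of the [j]-th linear inequality, with leading coefficient 1,
    so [u *m facets C] lists the values of all the functionals at [u]. *)
Definition facets g d (C : 'I_g -> 'M[R]_d) : 'M[R]_(g.+1, d) :=
  \matrix_(i, j) cons_tuple 1%:M C i j j.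

Lemma homogenize0 g (x : 'rV[R]_g) : homogenize x 0 0 = 1.
Proof. by rewrite mxE unlift_none. Qed.

Lemma homogenize_lift g (x : 'rV[R]_g) i : homogenize x 0 (lift ord0 i) = x 0 i.
Proof. by rewrite mxE liftK. Qed.

Lemma level1_free_diag g d (C : 'I_g -> 'M[R]_d) (x : 'rV[R]_g) :
  (forall i, is_diag_mx (C i)) ->
  level1 (free_spectrahedron C) x <->
  forall j, 0 <= (homogenize x *m facets C) 0 j.
Proof.
move=> dC.
have E : (fun i => (homogenize x 0 i)%:M) = cons_tuple 1%:M (fun i => (x 0 i)%:M : 'M[R]_1).
  by apply/funext=> i; rewrite /cons_tuple mxE; case: unliftP.
have F : level1 (free_spectrahedron C) x <->
    level1 (hom_free_spectrahedron (cons_tuple 1%:M C)) (homogenize x).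
  by rewrite /level1 /= E; exact: free_spectrahedronE.
have G j : (homogenize x *m facets C) 0 j =
    homogenize x 0 0 + \sum_(i < g) C i j j * homogenize x 0 (lift ord0 i).
  rewrite mxE big_ord_recl [facets _ _ _]mxE /cons_tuple unlift_none [1%:M _ _]mxE eqxx mulr1.
  congr (_ + _); apply: eq_bigr => i _.
  by rewrite [facets _ _ _]mxE /cons_tuple liftK mulrC.
split=> [/F /(level1_hom_diag _ dC) p j|p]; first by rewrite G.
by apply/F/(level1_hom_diag _ dC) => j; rewrite -G.
Qed.

Lemma quadrilateral_bounded (K : free_set R 2) :
  quadrilateral (level1 K) -> bounded_level1 K.
Proof.
move=> [v [_ KE]]; exists (\sum_k \sum_i `|v k 0 i|) => x; rewrite KE.
move=> [t [t0 t1 ->]] i; rewrite summxE (le_trans (ler_norm_sum _ _ _)) //.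
apply: ler_sum => k _; rewrite mxE normrM (bigD1 i) //= ler_wpDr ?sumr_ge0 //.
rewrite ler_piMl // ger0_norm // -t1 (bigD1 k) //= ler_wpDr ?sumr_ge0 //.
Qed.

Lemma small_step (J : finType) (a b : J -> R) :
  (forall j, 0 < a j) -> exists2 eps, 0 < eps & forall j, 0 < a j - eps * b j.
Proof.
move=> a0; have b1 j : 0 < `|b j| + 1 by rewrite ltr_wpDl.
(* The added 1 in the denominator leaves a slack that makes the inequality strict; the default value
   1 covers an empty [J]. *)
exists (\big[Num.min/1]_j (a j / (`|b j| + 1))).
  by rewrite lt_bigmin // => j _; rewrite divr_gt0.
move=> j; set eps := \big[_/_]_j _.
have eps_le : eps <= a j / (`|b j| + 1) by exact: bigmin_le_cond.
have eps0 : 0 <= eps by rewrite ltW // lt_bigmin // => k _; rewrite divr_gt0.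
have le1 : eps * b j <= eps * `|b j| by rewrite ler_wpM2l ?ler_norm.
have le2 : eps * (`|b j| + 1) <= a j by rewrite -ler_pdivlMr.
have [e0|e0] := eqVneq eps 0; first by rewrite e0 mul0r subr0.
have : 0 < eps by rewrite lt_neqAle eq_sym e0.
by lra.
Qed.

Definition affine_relation n (v : 'I_n -> 'rV[R]_2) (b : 'I_n -> R) : Prop :=
  \sum_i b i *: homogenize (v i) = 0.

Definition convex_position (v : 'I_4 -> 'rV[R]_2) : Prop :=
  forall i : 'I_4, ~ convex_hull (fun j : 'I_3 => v (lift i j)) (v i).

Lemma affine_relationE n (v : 'I_n -> 'rV[R]_2) (b : 'I_n -> R) :
  affine_relation v b <-> \sum_i b i = 0 /\ \sum_i b i *: v i = 0.
Proof.
have E0 : (\sum_i b i *: homogenize (v i)) 0 0 = \sum_i b i.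
  by rewrite summxE; apply: eq_bigr => i _; rewrite mxE homogenize0 mulr1.
have E k : (\sum_i b i *: homogenize (v i)) 0 (lift ord0 k) = (\sum_i b i *: v i) 0 k.
  by rewrite !summxE; apply: eq_bigr => i _; rewrite mxE homogenize_lift mxE.
split=> [rel|[b0 bv]].
  split; first by rewrite -E0 rel mxE.
  by apply/rowP=> k; rewrite -E rel !mxE.
apply/rowP=> k; case: (unliftP ord0 k) => [j|] ->; last by rewrite E0 b0 mxE.
by rewrite E bv !mxE.
Qed.

(* Otherwise the point with the unique positive coefficient would be a convex
   combination of the other three. *)
Lemma relation_second_pos (v : 'I_4 -> 'rV[R]_2) b i :
  convex_position v -> affine_relation v b -> 0 < b i ->
  exists2 j, j != i & 0 < b j.
Proof.
move=> cv /affine_relationE[b0 bv] bi0; apply: contrapT => nex; apply: (cv i).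
have bneg j : b (lift i j) <= 0.
  rewrite leNgt; apply/negP => bj; apply: nex; exists (lift i j) => //.
  by rewrite eq_sym neq_lift.
exists (fun j => - b (lift i j) / b i); split=> [j||].
- by rewrite divr_ge0 ?oppr_ge0 // ltW.
- rewrite -mulr_suml sumrN; move: b0; rewrite (bigD1_ord i) //= => /eqP.
  by rewrite addr_eq0 => /eqP <-; rewrite divff // gt_eqF.
- apply: (@scalerI _ _ (b i)); first by rewrite gt_eqF.
  move: bv; rewrite (bigD1_ord i) //= => /eqP; rewrite addr_eq0 => /eqP ->.
  rewrite scaler_sumr -sumrN; apply: eq_bigr => j _.
  by rewrite scalerA mulrC divfK ?gt_eqF // scaleNr.
Qed.

End Cones.

(** * Radon partition of the four vertices and the cone over them *)

Section Quadrilaterals.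
Variable R : realType.

Lemma affine_relationN n (v : 'I_n -> 'rV[R]_2) b :
  affine_relation v b -> affine_relation v (fun i => - b i).
Proof.
rewrite /affine_relation => rel; under eq_bigr do rewrite scaleNr.
by rewrite sumrN rel oppr0.
Qed.

Lemma sum_eq0_pos n (b : 'I_n -> R) i :
  \sum_i b i = 0 -> b i != 0 -> exists j, 0 < b j.
Proof.
move=> b0; apply: contraNP => nex; have bN j : 0 <= - b j.
  by rewrite oppr_ge0 leNgt; apply/negP => bj; apply: nex; exists j.
move: b0 => /eqP; rewrite -oppr_eq0 -sumrN psumr_eq0 // => /allP /(_ i).
by rewrite mem_index_enum oppr_eq0; apply.
Qed.

(** The coefficients sum to zero, so both signs occur; [relation_second_pos], applied to the
    relation and to its negative, supplies a second index of each sign. The pairs [p], [r] and [q],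
    [s] are the two diagonals. *)
Lemma relation_signs (v : 'I_4 -> 'rV[R]_2) b i :
  convex_position v -> affine_relation v b -> b i != 0 ->
  exists p q r s : 'I_4,
    [/\ uniq [:: p; q; r; s], 0 < b p, b q < 0, 0 < b r & b s < 0].
Proof.
move=> cv rel bi.
have relN := affine_relationN rel.
have /affine_relationE [b0 _] := rel; have /affine_relationE [bN0 _] := relN.
have [p bp] := sum_eq0_pos b0 bi.
have [q] : exists j, 0 < - b j by apply: (@sum_eq0_pos _ _ i) => //; rewrite oppr_eq0.
have [r rp br] := relation_second_pos cv rel bp.
move=> bNq; have [s sq] := relation_second_pos cv relN bNq.
move: bNq; rewrite !oppr_gt0 => bq bs.
have neq x y : 0 < b x -> b y < 0 -> x != y.
  by move=> bx; apply: contraTneq => <-; rewrite ltNge ltW.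
exists p, q, r, s; split=> //.
by rewrite /= !inE !negb_or (neq p q) // (neq p s) // (neq r s) // (eq_sym q r)
  (neq r q) // (eq_sym p r) rp (eq_sym q s) sq.
Qed.

Lemma uniq4_mem (p q r s x : 'I_4) :
  uniq [:: p; q; r; s] -> x \in [:: p; q; r; s].
Proof.
move=> u; have sub : {subset [:: p; q; r; s] <= enum 'I_4} by move=> y _; rewrite mem_enum.
by have [|_ ->] := uniq_min_size u sub; rewrite ?size_enum_ord ?mem_enum.
Qed.

Lemma uniq4_sum (V : nmodType) (p q r s : 'I_4) (F : 'I_4 -> V) :
  uniq [:: p; q; r; s] -> \sum_i F i = F p + (F q + (F r + F s)).
Proof.
move=> u; rewrite -big_enum /= (perm_big [:: p; q; r; s]) /=.
  by rewrite !big_cons big_nil addr0.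
apply: uniq_perm => // [|x]; first exact: enum_uniq.
by rewrite (uniq4_mem _ u) mem_enum.
Qed.

Lemma homogenize_sum g n (v : 'I_n -> 'rV[R]_g) (t : 'I_n -> R) :
  \sum_i t i = 1 -> homogenize (\sum_i t i *: v i) = \sum_i t i *: homogenize (v i).
Proof.
move=> t1; apply/rowP=> k; rewrite summxE.
case: (unliftP ord0 k) => [j|] ->.
  rewrite homogenize_lift summxE; apply: eq_bigr => i _.
  by rewrite !mxE liftK.
rewrite homogenize0 -t1; apply: eq_bigr => i _.
by rewrite mxE homogenize0 mulr1.
Qed.

Lemma relation_exists (v : 'I_4 -> 'rV[R]_2) :
  exists b i, affine_relation v b /\ b i != 0.
Proof.
pose W : 'M[R]_(4, 3) := \matrix_i homogenize (v i).
(* Four lifted points in a space of dimension three are linearly dependent. *)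
have : kermx W != 0.
  by rewrite -mxrank_eq0 mxrank_ker -lt0n subn_gt0 (leq_ltn_trans (rank_leq_col W)).
move=> /rowV0Pn[b /sub_kermxP bW] /rV0Pn[i bi].
exists (fun i => b 0 i), i; split=> //.
rewrite /affine_relation -[RHS]bW [RHS]mulmx_sum_row.
by apply: eq_bigr => k _; rewrite rowK.
Qed.

(* The four rays over the vertices, in cyclic order and scaled so that the two
   diagonals cross at p + r = q + s. *)
Lemma quadrilateral_cone d (C : 'I_2 -> 'M[R]_d) :
  (forall i, is_diag_mx (C i)) ->
  quadrilateral (level1 (free_spectrahedron C)) ->
  exists p q r s : 'rV[R]_3,
    [/\ p + r = q + s,
        forall x y z, x *: p + y *: q + z *: r = 0 -> [/\ x = 0, y = 0 & z = 0],
        forall u : 'rV[R]_3, u \in [:: p; q; r; s] ->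
          0 < u 0 0 /\ forall j, 0 <= (u *m facets C) 0 j &
        forall u : 'rV[R]_3, 0 < u 0 0 -> (forall j, 0 <= (u *m facets C) 0 j) ->
          exists x y z t, [/\ 0 <= x, 0 <= y, 0 <= z, 0 <= t &
            u = x *: p + y *: q + z *: r + t *: s]].
Proof.
move=> dC [v [cv KE]].
have [b [i0 [rel bi0]]] := relation_exists v.
have [p [q [r [s [u4 bp bq br bs]]]]] := relation_signs cv rel bi0.
pose w i := homogenize (v i).
(* By [relation_signs] a nontrivial relation has no zero coefficient, so one that vanishes at [s] is
   trivial: the other three lifts are independent. *)
have ind c : affine_relation v c -> c s = 0 -> forall i, c i = 0.
  move=> relc cs i; apply/eqP; apply: contraT => ci.
  have [p' [q' [r' [s' [u4' cp cq cr cs']]]]] := relation_signs cv relc ci.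
  have := uniq4_mem s u4'; rewrite !inE => /or4P[] /eqP E; move: cs;
  by rewrite E => E0; move: cp cq cr cs'; rewrite E0 ltxx.
(* Scaling each lift by the absolute value of its coefficient turns the relation into p + r = q +
   s. *)
exists (b p *: w p), (- b q *: w q), (b r *: w r), (- b s *: w s); split.
- move: rel; rewrite /affine_relation (uniq4_sum _ u4) -!/(w _) !scaleNr.
  move=> E; apply/eqP; rewrite -opprD -subr_eq0 opprK addrACA -[X in _ == X]E.
  by rewrite !addrA.
- move=> x y z E; have := u4; rewrite /= !inE !negb_or.
  move=> /and4P[/and3P[pq pr ps] /andP[qr qs] rs _].
  pose c i := if i == p then x * b p else if i == q then - (y * b q) else
              if i == r then z * b r else 0.
  have cE : [/\ c p = x * b p, c q = - (y * b q), c r = z * b r & c s = 0].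
    rewrite /c !eqxx ![_ == p]eq_sym [r == q]eq_sym [s == q]eq_sym [s == r]eq_sym.
    by rewrite (negPf pq) (negPf pr) (negPf ps) (negPf qr) (negPf qs) (negPf rs).
  have [cp cq cr cs] := cE.
  have relc : affine_relation v c.
    rewrite /affine_relation (uniq4_sum _ u4) cp cq cr cs scale0r addr0.
    by rewrite -mulrN -!scalerA addrA.
  have c0 := ind c relc cs; move: (c0 p) (c0 q) (c0 r).
  rewrite cp cq cr => /eqP + /eqP + /eqP; rewrite oppr_eq0 !mulf_eq0.
  by rewrite (gt_eqF bp) (lt_eqF bq) (gt_eqF br) !orbF => /eqP -> /eqP -> /eqP ->.
- move=> u; rewrite !inE.
  have posw i a : 0 < a -> u = a *: w i ->
      0 < u 0 0 /\ forall j, 0 <= (u *m facets C) 0 j.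
    move=> a0 ->; split=> [|j]; first by rewrite mxE homogenize0 mulr1.
    rewrite -scalemxAl mxE mulr_ge0 ?(ltW a0) //.
    have : level1 (free_spectrahedron C) (v i).
      rewrite KE; exists (fun k => (k == i)%:R); split=> [k||].
      - by rewrite ler0n.
      - by rewrite (bigD1 i) //= eqxx big1 ?addr0 // => k /negPf ->.
      - by rewrite (bigD1 i) //= eqxx scale1r big1 ?addr0 // => k /negPf ->; rewrite scale0r.
    by move=> /(level1_free_diag _ dC).
  by move=> /or4P[] /eqP; apply: posw; rewrite ?oppr_gt0.
- move=> u u0 pu.
  (* A point of positive height is a positive multiple of the lift of a point of the plane, to which
     the convex hull description applies. *)
  have uE : homogenize ((u 0 0)^-1 *: \row_i u 0 (lift ord0 i)) = (u 0 0)^-1 *: u.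
    apply/rowP=> k; case: (unliftP ord0 k) => [j|] ->.
      by rewrite homogenize_lift !mxE.
    by rewrite homogenize0 mxE mulVf // gt_eqF.
  have : level1 (free_spectrahedron C) ((u 0 0)^-1 *: \row_i u 0 (lift ord0 i)).
    apply/(level1_free_diag _ dC) => j.
    by rewrite uE -scalemxAl mxE mulr_ge0 // invr_ge0 ltW.
  rewrite KE => -[t [t0 t1 tE]].
  have hu : u = \sum_i (u 0 0 * t i) *: w i.
    transitivity (u 0 0 *: ((u 0 0)^-1 *: u)).
      by rewrite scalerA divff ?gt_eqF // scale1r.
    rewrite -uE tE homogenize_sum // scaler_sumr.
    by apply: eq_bigr => k _; rewrite scalerA.
  exists (u 0 0 * t p / b p), (u 0 0 * t q / - b q), (u 0 0 * t r / b r), (u 0 0 * t s / - b s).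
  split; try by rewrite divr_ge0 ?mulr_ge0 ?oppr_ge0 // ltW.
  rewrite [LHS]hu (uniq4_sum _ u4) !scalerA !divfK ?oppr_eq0 ?addrA //;
    by rewrite ?(gt_eqF bp) ?(lt_eqF bq) ?(gt_eqF br) ?(lt_eqF bs).
Qed.

End Quadrilaterals.

(** * Identification of the facets and the model cone *)

Section NormalForm.
Variable R : realType.

Local Notation o1 := (lift ord0 ord0 : 'I_3).
Local Notation o2 := (lift ord0 (lift ord0 ord0) : 'I_3).

Lemma sum_ord3 (V : nmodType) (F : 'I_3 -> V) :
  \sum_i F i = F ord0 + (F o1 + F o2).
Proof. by rewrite !big_ord_recl big_ord0 addr0. Qed.

(** If all functionals were positive at [e], a small step along [- z] would keep them and the height
    positive, against the hypothesis. *)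
Lemma supporting_facet g d (N : 'M[R]_(g.+1, d)) (e z : 'rV[R]_g.+1) :
  0 < e 0 0 ->
  (forall eps, 0 < eps -> 0 < (e - eps *: z) 0 0 ->
     ~ forall j, 0 <= ((e - eps *: z) *m N) 0 j) ->
  exists j, (e *m N) 0 j <= 0.
Proof.
move=> e0 out; apply: contrapT => nex.
have eN j : 0 < (e *m N) 0 j.
  by rewrite ltNge; apply/negP => ej; apply: nex; exists j.
(* The index [None] stands for the height, so that one step length serves it and all the
   functionals. *)
pose val (x : 'rV[R]_g.+1) (j : option 'I_d) := if j is Some j then (x *m N) 0 j else x 0 0.
have [|eps eps0 pe] := @small_step R _ (val e) (val z); first by case.
have valE j : val e j - eps * val z j = val (e - eps *: z) j.
  by case: j => [j|]; rewrite /= ?mulmxBl -?scalemxAl !mxE.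
apply: (out eps eps0) => [|j]; first by have := pe None; rewrite valE.
by have := pe (Some j); rewrite valE => /ltW.
Qed.

(** At size one this is the cone over the coordinate vectors of p, q, r and over (1, -1, 1), the
    coordinates of s. In the listed order the inequalities are the facets through q and r, p and q,
    r and s, s and p. *)
Definition model_cone : free_set R 3 := fun n => [set Z |
  symmetric_tuple Z /\ [/\ psdmx (Z ord0), psdmx (Z o2),
    psdmx (Z ord0 + Z o1) & psdmx (Z o1 + Z o2)]].

(** The scalars [x], [y], [z], [x - y + z] are the values of a functional on the rays p, q, r, s. A
    functional nonnegative on all four is a nonnegative combination of facet functionals, which ones
    depending on the sign of [x - y]. *)
Lemma model_cone_psd n (Z : 'I_3 -> 'M[R]_n) (x y z : R) :
  model_cone Z -> 0 <= x -> 0 <= y -> 0 <= z -> 0 <= x - y + z ->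
  psdmx (x *: Z ord0 + (y *: Z o1 + z *: Z o2)).
Proof.
move=> [_ [p0 p2 p01 p12]] x0 y0 z0 xyz.
have [xy|yx] := leP x y.
  have -> : x *: Z ord0 + (y *: Z o1 + z *: Z o2) =
      x *: (Z ord0 + Z o1) + (y - x) *: (Z o1 + Z o2) + (x - y + z) *: Z o2.
    by apply/matrixP=> a b; rewrite !mxE; ring.
  by do 2?apply: psdmxD; apply: psdmxZ; rewrite ?subr_ge0.
have -> : x *: Z ord0 + (y *: Z o1 + z *: Z o2) =
    y *: (Z ord0 + Z o1) + (x - y) *: Z ord0 + z *: Z o2.
  by apply/matrixP=> a b; rewrite !mxE; ring.
by do 2?apply: psdmxD; apply: psdmxZ => //; rewrite subr_ge0 ltW.
Qed.

Lemma hom_quadrilateral_normal_form d (C : 'I_2 -> 'M[R]_d) :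
  (forall i, is_diag_mx (C i)) ->
  quadrilateral (level1 (free_spectrahedron C)) ->
  exists2 G : 'M[R]_3, G \in unitmx &
    hom_free_spectrahedron (cons_tuple 1%:M C) = lin_image G model_cone.
Proof.
move=> dC qC; set N := facets C.
have [p [q [r [s [psE ind cone hull]]]]] := quadrilateral_cone dC qC.
rewrite -/N in cone hull.
have sE : s = p + r - q by rewrite psE addrC addKr.
have [[p0 pN] [q0 qN] [r0 rN] [s0 sN]] : [/\ (0 < p 0 0 /\ forall j, 0 <= (p *m N) 0 j),
  (0 < q 0 0 /\ forall j, 0 <= (q *m N) 0 j), (0 < r 0 0 /\ forall j, 0 <= (r *m N) 0 j) &
  (0 < s 0 0 /\ forall j, 0 <= (s *m N) 0 j)].
  by split; apply: cone; rewrite !inE eqxx ?orbT.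
have sNE j : (s *m N) 0 j = (p *m N) 0 j - (q *m N) 0 j + (r *m N) 0 j.
  by rewrite sE mulmxBl mulmxDl !mxE; ring.
pose rows (i : 'I_3) := if i == ord0 then p else if i == o1 then q else r.
pose U := \matrix_i rows i.
have uU : U \in unitmx.
  rewrite -row_free_unit -kermx_eq0; apply: contraT => /rowV0Pn[x /sub_kermxP xU].
  move: xU; rewrite mulmx_sum_row sum_ord3 !rowK /rows /= addrA => /ind[x0 x1 x2].
  apply: contraNT => _; apply/eqP/rowP=> i; rewrite mxE.
  case: (unliftP ord0 i) => [j|] -> //; case: (unliftP ord0 j) => [k|] -> //.
  by rewrite ord1.
have UN i j : (U *m N) i j = (rows i *m N) 0 j.
  by rewrite -[rows i]rowK -row_mul !mxE.
(* A functional vanishing on the basis would be zero, but its leading coefficient is 1. *)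
have nonzero j : (p *m N) 0 j = 0 -> (q *m N) 0 j = 0 -> (r *m N) 0 j != 0.
  move=> pj qj; apply/eqP => rj.
  have : U *m col j N = 0.
    apply/colP=> i; rewrite colE mulmxA -colE [LHS]mxE UN [RHS]mxE /rows.
    by case: ifP => // _; case: ifP.
  move=> /(congr1 (mulmx (invmx U))); rewrite mulKmx // mulmx0 => /colP/(_ ord0).
  by rewrite !mxE /cons_tuple unlift_none mxE eqxx => /eqP; rewrite oner_eq0.
(* Here [x1 + x2] lies over the interior of an edge and moving along [- z] leaves the cone. The
   functional supplied by [supporting_facet] has two nonnegative values with sum at most 0, so both
   vanish. *)
have edge (x1 x2 z : 'rV[R]_3) : 0 < x1 0 0 -> 0 < x2 0 0 ->
    (forall j, 0 <= (x1 *m N) 0 j) -> (forall j, 0 <= (x2 *m N) 0 j) ->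
    (forall eps a b c t, 0 < eps -> 0 <= a -> 0 <= b -> 0 <= c -> 0 <= t ->
       x1 + x2 - eps *: z = a *: p + b *: q + c *: r + t *: s -> False) ->
    exists j, (x1 *m N) 0 j = 0 /\ (x2 *m N) 0 j = 0.
  move=> x10 x20 x1N x2N out.
  have [||j] := @supporting_facet _ _ N (x1 + x2) z.
  - by rewrite mxE addr_gt0.
  - move=> eps eps0 pos /(hull _ pos)[a [b [c [t [a0 b0 c0 t0 E]]]]].
    exact: (out eps a b c t).
  - rewrite mulmxDl mxE => le0; exists j; have := x1N j; have := x2N j.
    by split; lra.
(* Substituting s = p + r - q and comparing coordinates in the basis p, q, r, the r-coordinate gives
   [- eps = c + t], which is impossible. *)
have [j1 [pj1 qj1]] : exists j, (p *m N) 0 j = 0 /\ (q *m N) 0 j = 0.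
  apply: (edge p q r) => // eps a b c t eps0 a0 b0 c0 t0 E.
  have [|_ _] := ind (1 - a - t) (1 - b + t) (- eps - c - t); last by lra.
  apply/rowP=> k; have := congr1 (fun u : 'rV_3 => u 0 k) E.
  by rewrite /= sE !mxE => Ek; lra.
have [j2 [qj2 rj2]] : exists j, (q *m N) 0 j = 0 /\ (r *m N) 0 j = 0.
  apply: (edge q r p) => // eps a b c t eps0 a0 b0 c0 t0 E.
  have [|+ _ _] := ind (- eps - a - t) (1 - b + t) (1 - c - t); last by lra.
  apply/rowP=> k; have := congr1 (fun u : 'rV_3 => u 0 k) E.
  by rewrite /= sE !mxE => Ek; lra.
(* Now the q-coordinate forces [t] to be at least 1, while the p-coordinate bounds it by
   [1 - eps]. *)
have [j3 [rj3 sj3]] : exists j, (r *m N) 0 j = 0 /\ (s *m N) 0 j = 0.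
  apply: (edge r s p) => // eps a b c t eps0 a0 b0 c0 t0 E.
  have [|] := ind (1 - eps - a - t) (- 1 - b + t) (2 - c - t); last by lra.
  apply/rowP=> k; have := congr1 (fun u : 'rV_3 => u 0 k) E.
  by rewrite /= sE !mxE => Ek; lra.
have [j4 [sj4 pj4]] : exists j, (s *m N) 0 j = 0 /\ (p *m N) 0 j = 0.
  apply: (edge s p r) => // eps a b c t eps0 a0 b0 c0 t0 E.
  have [|] := ind (2 - a - t) (- 1 - b + t) (1 - eps - c - t); last by lra.
  apply/rowP=> k; have := congr1 (fun u : 'rV_3 => u 0 k) E.
  by rewrite /= sE !mxE => Ek; lra.
(* In the variables [Z] the coefficients of functional [j] are its values at p, q and r. *)
have coefs n (Z : 'I_3 -> 'M[R]_n) j :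
    \sum_k cons_tuple 1%:M C k j j *: lin_tuple U^T Z k =
    (p *m N) 0 j *: Z ord0 + ((q *m N) 0 j *: Z o1 + (r *m N) 0 j *: Z o2).
  transitivity (\sum_i (U *m N) i j *: Z i); last by rewrite sum_ord3 !UN.
  under eq_bigr do rewrite scaler_sumr.
  rewrite exchange_big; apply: eq_bigr => i _; rewrite mxE scaler_suml.
  by apply: eq_bigr => k _; rewrite scalerA mulrC; congr (_ * _ *: _); rewrite !mxE.
have homE n (Z : 'I_3 -> 'M[R]_n) : symmetric_tuple Z ->
    hom_free_spectrahedron (cons_tuple 1%:M C) (lin_tuple U^T Z) <->
    forall j, psdmx ((p *m N) 0 j *: Z ord0 +
                     ((q *m N) 0 j *: Z o1 + (r *m N) 0 j *: Z o2)).
  move=> sZ; have sX : symmetric_tuple (lin_tuple U^T Z).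
    move=> k; rewrite /lin_tuple linear_sum; apply: eq_bigr => i _.
    by rewrite linearZ /= sZ.
  have D := psdmx_hpencil_diag (is_diag_cons dC) sX.
  split=> [[_ /D HX] j|HX]; first by rewrite -coefs.
  by split=> //; apply/D => j; rewrite coefs.
have scale_psd n a (M : 'M[R]_n) : 0 < a -> psdmx (a *: M) -> psdmx M.
  move=> a0 /(psdmxZ (a := a^-1)); rewrite scalerA mulVf ?gt_eqF // scale1r.
  by apply; rewrite invr_ge0 ltW.
exists U^T; first by rewrite unitmx_tr.
apply/functional_extensionality_dep=> n; apply/seteqP; split=> X.
  move=> HX; have [sX _] := HX; pose Z := lin_tuple (invmx U^T) X.
  have XE : lin_tuple U^T Z = X.
    by rewrite -lin_tupleM mulmxV ?unitmx_tr // lin_tuple1.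
  have sZ : symmetric_tuple Z.
    move=> k; rewrite /Z /lin_tuple linear_sum; apply: eq_bigr => i _.
    by rewrite linearZ /= sX.
  move: HX; rewrite -XE => /(homE _ _ sZ) HZ; exists Z => //; split=> //.
  have pos a : 0 <= a -> a != 0 -> 0 < a by move=> a0 an; rewrite lt_neqAle eq_sym an.
  (* Each inequality of the model is a positive multiple of one edge functional: [j2], [j1], [j3],
     [j4] in turn. For [j3] and [j4], vanishing at s makes the two remaining coefficients equal. *)
  split.
  - have := HZ j2; rewrite qj2 rj2 !scale0r !addr0; apply: scale_psd.
    by apply: pos => //; apply/eqP => pj2; have := nonzero j2 pj2 qj2; rewrite rj2 eqxx.
  - have := HZ j1; rewrite pj1 qj1 !scale0r !add0r; apply: scale_psd.
    by apply: pos => //; exact: nonzero.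
  - have qp : (q *m N) 0 j3 = (p *m N) 0 j3 by have := sNE j3; lra.
    have := HZ j3; rewrite qp rj3 scale0r addr0 -scalerDr; apply: scale_psd.
    apply: pos => //; apply/eqP => pj3; have := nonzero j3 pj3.
    by rewrite qp pj3 rj3 eqxx => /(_ erefl).
  - have qr : (r *m N) 0 j4 = (q *m N) 0 j4 by have := sNE j4; lra.
    have := HZ j4; rewrite qr pj4 scale0r add0r -scalerDr; apply: scale_psd.
    by apply: pos => //; apply/eqP => qj4; have := nonzero j4 pj4 qj4; rewrite qr qj4 eqxx.
(* Conversely every functional, whether or not it is one of the four edge functionals, is
   nonnegative on the four rays. *)
move=> [Z HZ <-]; have [sZ _] := HZ; apply/(homE _ _ sZ) => j.
by apply: model_cone_psd => //; rewrite -sNE.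
Qed.

End NormalForm.

(** * Projective equivalence of free quadrilaterals *)

Lemma homogenization_normal_form (R : realType) (K : free_set R 2) :
  free_quadrilateral K ->
  exists (C : 'I_2 -> 'M[R]_4) (G : 'M[R]_3),
    [/\ forall i, is_diag_mx (C i), K = free_spectrahedron C,
        homogenization K = hom_free_spectrahedron (cons_tuple 1%:M C),
        G \in unitmx & homogenization K = lin_image G (@model_cone R)].
Proof.
(* The diagonal tuple [C] comes from the definition of a free quadrilateral and may differ from the
   tuple that defines [K] in the theorem. *)
move=> [qK [C [dC KE]]]; subst K.
have [G uG HG] := hom_quadrilateral_normal_form dC qK.
have HE := homogenizationE (isT : 0 < 4)%N (is_diag_symmetric dC) (quadrilateral_bounded qK).
by exists C, G; split=> //; rewrite HE.
Qed.

Theorem lemma4p1 (R : realType) (d e : nat)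
    (A : 'I_2 -> 'M[R]_d) (B : 'I_2 -> 'M[R]_e)
    (symA : symmetric_tuple A) (symB : symmetric_tuple B)
    (quadA : free_quadrilateral (free_spectrahedron A))
    (quadB : free_quadrilateral (free_spectrahedron B)) :
  exists W : 'M[R]_3,
    [/\ W \in unitmx,
        projective_transformation W (free_spectrahedron A) &
        projective_image W (free_spectrahedron A) = free_spectrahedron B].
Proof.
have [_ [GA [_ _ _ uA HA]]] := homogenization_normal_form quadA.
have [E [GB [dE KB HB uB HB']]] := homogenization_normal_form quadB.
(* The inverse of [GA] carries the homogenization of the first quadrilateral to the model cone, and
   [GB] carries the model cone to that of the second. *)
pose W := GB *m invmx GA.
have WE : lin_image W (homogenization (free_spectrahedron A)) =
          hom_free_spectrahedron (cons_tuple 1%:M E).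
  by rewrite HA -lin_imageM /W -mulmxA mulVmx // mulmx1 -HB' HB.
exists W; split; first by rewrite unitmx_mul uB unitmx_inv.
- rewrite /projective_transformation WE; split; last exact: positive_hom_diag.
  exists 4%N, (cons_tuple 1%:M E); split=> //.
  by apply: symmetric_cons_tuple; [exact: trmx1 | exact: is_diag_symmetric].
- by rewrite /projective_image WE dehomogenization_free KB.
Qed.
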